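(* Let $\Delta$ be a building whose apartments are isomorphic to the Coxeter complex of a Coxeter system $(W,S)$. If the dual graph $\Delta'$ of $\Delta$ is a hyperbolic metric space, then the Coxeter group $W$ is word hyperbolic.
   Context: Coxeter systems $(W,S)$ have $S$ finite. Buildings are simplicial complexes that are unions of apartments in the usual sense (thickness and local finiteness are not assumed). Dual graph: $\Delta'$ is the graph whose vertices are (the barycenters of) the chambers of $\Delta$, two distinct chambers being joined by an edge when they have a common codimension-one face (which is the empty face if $|S|=1$). Each edge of $\Delta'$ is taken to be isometric to the unit interval, and $\Delta'$ carries the induced path metric. Hyperbolicity: a geodesic metric space $(X,d)$ is one in which any two points are joined by a path realizing their distance (a geodesic). It is $\delta$-hyperbolic if whenever $P$ is a point on side $\alpha$ of a geodesic triangle with sides $\alpha,\beta,\gamma$, there is a point $Q$ on $\beta\cup\gamma$ with $d(P,Q)\le\delta$; it is hyperbolic if it is $\delta$-hyperbolic for some $\delta$. A finitely generated group is (word) hyperbolic if its Cayley graph with respect to some (equivalently, any) finite generating set, with edges of length one, is hyperbolic. *)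

(* Defs.v *)
From HB Require Import structures.
From mathcomp Require Export all_boot all_order all_algebra finmap.
From mathcomp Require Export all_classical reals.

Set Implicit Arguments.
Unset Strict Implicit.
Unset Printing Implicit Defensive.

Import Order.TTheory GRing.Theory Num.Theory.
Local Open Scope classical_set_scope.
Local Open Scope ring_scope.

(** ** Geodesic and hyperbolic metric spaces *)

Definition is_metric (R : realType) (X : Type) (d : X -> X -> R) : Prop :=
  [/\ forall x y, d x y = 0 <-> x = y,
      forall x y, d x y = d y x
    & forall x y z, d x z <= d x y + d y z].

(* A path realizing the distance from [x] to [y], parametrized by arc length;
   only the values of [g] on [0, d x y] matter. *)
Definition is_geodesic (R : realType) (X : Type) (d : X -> X -> R)
    (x y : X) (g : R -> X) : Prop :=
  [/\ g 0 = x, g (d x y) = y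
    & forall s t : R, 0 <= s <= d x y -> 0 <= t <= d x y ->
        d (g s) (g t) = `|s - t|].

Definition is_geodesic_segment (R : realType) (X : Type) (d : X -> X -> R)
    (x y : X) (A : set X) : Prop :=
  exists2 g : R -> X, is_geodesic d x y g
    & A = g @` [set t : R | 0 <= t <= d x y].

Definition is_geodesic_space (R : realType) (X : Type) (d : X -> X -> R) : Prop :=
  is_metric d /\ forall x y, exists g, is_geodesic d x y g.

(* A segment from [x] to [y] is also one from [y] to [x], so letting the
   corners vary lets [alpha] be any side of the triangle. *)
Definition delta_hyperbolic (R : realType) (X : Type) (d : X -> X -> R)
    (delta : R) : Prop :=
  forall (x y z : X) (alpha beta gamma : set X),
    is_geodesic_segment d x y alpha ->
    is_geodesic_segment d y z beta ->
    is_geodesic_segment d z x gamma ->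
    forall P, alpha P -> exists2 Q, (beta `|` gamma) Q & d P Q <= delta.

Definition hyperbolic (R : realType) (X : Type) (d : X -> X -> R) : Prop :=
  is_geodesic_space d /\ exists delta : R, delta_hyperbolic d delta.

(** ** Metric graphs *)

(* The point at parameter [t] on the edge from [u] to [v], given by its
   barycentric coordinates: [1 - t] at [u] and [t] at [v]. *)
Definition edge_coord (R : realType) (T : choiceType) (u v : T) (t : R) : T -> R :=
  fun w => (1 - t) * (w == u)%:R + t * (w == v)%:R.

(* The geometric realization of the simple graph [adj], as a set of
   barycentric coordinate functions.  [edge_coord u v t], [edge_coord v u (1 - t)]
   are the same point, and [edge_coord u u 0] is the vertex [u]. *)
Definition realization (R : realType) (T : choiceType) (adj : T -> T -> Prop)
    : set (T -> R) :=
  [set x | (exists u, x = edge_coord u u 0) \/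
           exists u v (t : R), [/\ adj u v, 0 <= t <= 1 & x = edge_coord u v t]].
Arguments realization R {T} adj.

(* [pl_path x y l]: there is a piecewise linear path of length [l] from [x] to
   [y], each piece lying in one edge, which is isometric to the unit interval. *)
Inductive pl_path (R : realType) (T : choiceType) (adj : T -> T -> Prop) :
    realization R adj -> realization R adj -> R -> Prop :=
| pl_path_nil x : pl_path x x 0
| pl_path_cons (x y z : realization R adj) (u v : T) (s t l : R) :
    adj u v -> 0 <= s <= 1 -> 0 <= t <= 1 ->
    val x = edge_coord u v s -> val y = edge_coord u v t ->
    pl_path y z l -> pl_path x z (`|s - t| + l).

(* The induced path metric.  If the graph is disconnected, [inf] takes the junk
   value [0] on the empty set, and then [graph_dist] does not satisfy
   [is_metric]. *)
Definition graph_dist (R : realType) (T : choiceType) (adj : T -> T -> Prop)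
    (x y : realization R adj) : R :=
  inf [set l | pl_path x y l].

(** ** Groups, Cayley graphs and Coxeter systems *)

Definition is_subgroup (W : groupType) (H : set W) : Prop :=
  [/\ H 1%g, forall x y, H x -> H y -> H (x * y)%g & forall x, H x -> H (x^-1)%g].

Definition gen (W : groupType) (X : set W) : set W := smallest (@is_subgroup W) X.

Definition cayley_adj (W : groupType) (X : {fset W}) (g h : W) : Prop :=
  g <> h /\ exists2 x, x \in X & h = (g * x)%g \/ g = (h * x)%g.

Definition word_hyperbolic (R : realType) (W : groupType) : Prop :=
  exists X : {fset W}, gen [set` X] = setT /\
    hyperbolic (@graph_dist R _ (cayley_adj X)).

Definition has_order (W : groupType) (x : W) (n : nat) : Prop :=
  [/\ (0 < n)%N, (x ^+ n)%g = 1%g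
    & forall k, (0 < k)%N -> (x ^+ k)%g = 1%g -> (n <= k)%N].

(* [W] is generated by the finite set [S] of elements of order 2 and has the
   presentation < S | (s t)^m(s,t) = 1 >, where [m(s,t)] is the order of [s t]
   and there is no relation when that order is infinite.  The presentation is
   expressed by its universal property. *)
Definition coxeter_system (W : groupType) (S : {fset W}) : Prop :=
  [/\ forall s, s \in S -> has_order s 2,
      gen [set` S] = setT
    & forall (G : groupType) (f : W -> G),
        (forall s t m, s \in S -> t \in S -> has_order (s * t)%g m ->
           ((f s * f t) ^+ m)%g = 1%g) ->
        exists phi : {multiplicative W -> G}, forall s, s \in S -> phi s = f s].

(* The standard cosets [w W_J] with [J] contained in [S]; [J = S] is allowed. *)
Definition standard_cosets (W : groupType) (S : {fset W}) : set (set W) :=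
  [set A | exists (w : W) (J : set W),
     J `<=` [set` S] /\ A = [set (w * x)%g | x in gen J]].

(** ** Simplicial complexes and buildings *)

(* A complex is given by its set of simplices, the empty one included; its
   vertices are the [v] such that [[fset v]] is a simplex. *)
Definition simplicial_complex (V : choiceType) (K : set {fset V}) : Prop :=
  K fset0 /\ forall F G : {fset V}, K G -> (F `<=` G)%fset -> K F.

(* A map of vertices that induces a bijection of simplices (in particular of
   the simplices [[fset v]], that is, of vertices). *)
Definition simplicial_iso (V : choiceType) (K L : set {fset V}) (f : V -> V) : Prop :=
  set_bij K L (fun F : {fset V} => (f @` F)%fset).

(* The Coxeter complex of [(W, S)] is the poset of standard cosets ordered by
   reverse inclusion: the coset [w W_J] is the simplex of codimension [#|J|], so
   that the singletons [{w}] are the chambers and [W] is the empty simplex.  An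
   isomorphism of complexes is an isomorphism of their face posets. *)
Definition iso_coxeter_complex (W : groupType) (S : {fset W})
    (V : choiceType) (K : set {fset V}) : Prop :=
  exists2 phi : {fset V} -> set W, set_bij K (standard_cosets S) phi
    & forall F G, K F -> K G -> ((F `<=` G)%fset <-> phi G `<=` phi F).

Definition building (W : groupType) (S : {fset W})
    (V : choiceType) (Delta : set {fset V}) : Prop :=
  simplicial_complex Delta /\
  exists Apt : set (set {fset V}),
    [/\ Delta = \bigcup_(A in Apt) A,
        forall A, Apt A -> simplicial_complex A /\ iso_coxeter_complex S A,
        forall F G, Delta F -> Delta G -> exists A, [/\ Apt A, A F & A G]
      & forall A B F G, Apt A -> Apt B -> A F -> A G -> B F -> B G ->
          exists f : V -> V, simplicial_iso A B f /\
            forall v, v \in (F `|` G)%fset -> f v = v].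

Definition is_chamber (V : choiceType) (Delta : set {fset V}) : set {fset V} :=
  [set C | Delta C /\ forall D, Delta D -> (C `<=` D)%fset -> D = C].

(* Distinct chambers [C], [D] with a common face [F] of codimension one in both. *)
Definition chamber_adj (V : choiceType) (Delta : set {fset V})
    (C D : is_chamber Delta) : Prop :=
  val C <> val D /\
  exists F : {fset V},
    [/\ (F `<=` val C)%fset, (F `<=` val D)%fset,
        #|` val C | = #|` F |.+1 & #|` val D | = #|` F |.+1].

Definition dual_graph_dist (R : realType) (V : choiceType) (Delta : set {fset V}) :=
  @graph_dist R _ (@chamber_adj V Delta).

(* Main.v *)
Require Import Defs.
From mathcomp Require Import lra ring.
Local Open Scope classical_set_scope.

Set Implicit Arguments.
Unset Strict Implicit.
Unset Printing Implicit Defensive.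

Import Order.TTheory GRing.Theory Num.Theory.
Local Open Scope ring_scope.

(** The Cayley graph of [W] with respect to [S] is a retract of the dual graph
    of the building, by maps that do not increase distances; and such a retract
    of a hyperbolic space is hyperbolic, with the same constant.

    Fix an apartment [A].  Its chambers are the singleton cosets [{w}], and two
    of them share a panel exactly when they are [{w}] and [{w s}] with [s] in
    [S] ([coxeter_chambers]); so [w |-> {w}] carries the Cayley graph into the
    dual graph.  In the other direction is the retraction onto [A] centred at a
    chamber [C] of [A]: a chamber [D] lies with [C] in some apartment [B], and
    [D] goes to its image under an isomorphism [B -> A] that fixes [C]
    pointwise.  An isomorphism of apartments is determined by its values on one
    chamber ([iso_rigid]), which makes the image of a simplex independent of
    [B]; hence the two images of a panel common to adjacent chambers agree, and
    the images of the chambers are equal or adjacent ([building_retraction]).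

    A map of graphs that sends each edge to an edge or a vertex extends to the
    realizations and does not increase the path metric ([graph_dist_map]).  If
    [r] and [i] are such extensions and [r] after [i] is the identity, then [i]
    is an isometric embedding, so a triangle downstairs becomes a triangle
    upstairs whose sides are in the image of [i], and thinness of the latter is
    thinness of the former.  Geodesics downstairs are the images under [r] of
    geodesics upstairs ([hyperbolic_retract]). *)

(** * Metric retracts *)

(** The image is a path of length at most [dX x y] between points at exactly
    that distance, so the triangle inequality leaves it no room to shorten any
    of its pieces. *)
Lemma contraction_geodesic (R : realType) (X Y : Type)
    (dX : X -> X -> R) (dY : Y -> Y -> R) (r : X -> Y) (x y : X) (g : R -> X) :
  is_metric dY -> (forall a b, dY (r a) (r b) <= dX a b) ->
  dY (r x) (r y) = dX x y ->
  is_geodesic dX x y g -> is_geodesic dY (r x) (r y) (r \o g).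
Proof.
move=> [_ dC dT] rL rxy [g0 g1 gd]; rewrite /is_geodesic rxy; split => /=.
- by rewrite g0.
- by rewrite g1.
have L0 : 0 <= dX x y.
  have := dT (r x) (r y) (r x); have := dT (r x) (r x) (r x).
  rewrite (dC (r y)) rxy; lra.
have key (s t : R) : 0 <= s <= dX x y -> 0 <= t <= dX x y -> s <= t ->
    dY (r (g s)) (r (g t)) = t - s.
  move=> hs ht st; have /andP[s0 s1] := hs; have /andP[t0 t1] := ht.
  have h0 : 0 <= (0 : R) <= dX x y by rewrite lexx.
  have h1 : 0 <= dX x y <= dX x y by rewrite lexx andbT.
  have := rL (g 0) (g s); have := rL (g s) (g t); have := rL (g t) (g (dX x y)).
  rewrite !gd // g0 g1 => a b c.
  have := dT (r x) (r (g s)) (r y); have := dT (r (g s)) (r (g t)) (r y).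
  rewrite rxy; move: a b c.
  rewrite sub0r normrN (distrC t) (distrC s) !ger0_norm ?subr_ge0 //; lra.
move=> s t hs ht; case: (lerP s t) => st.
  by rewrite key // distrC ger0_norm // subr_ge0.
by rewrite dC key // ?ger0_norm ?subr_ge0 ltW.
Qed.

(** The embedding [i] carries geodesic triangles to geodesic triangles, so
    thinness is inherited with the same constant.  Existence of geodesics is not
    inherited through [i], because a geodesic between points of the image may
    leave it; composing it with [r] brings it back. *)
Lemma hyperbolic_retract (R : realType) (X Y : Type)
    (dX : X -> X -> R) (dY : Y -> Y -> R) (i : Y -> X) (r : X -> Y) :
  (forall a b, dX (i a) (i b) = dY a b) ->
  (forall a b, dY (r a) (r b) <= dX a b) -> cancel i r ->
  hyperbolic dX -> hyperbolic dY.
Proof.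
move=> iI rL iK [[[d0 dC dT] geo] [delta hyp]].
have mY : is_metric dY.
  split=> [a b|a b|a b c]; rewrite -!iI //.
  by rewrite d0; split=> [/(can_inj iK)|->].
split.
  split=> // a b; have [g gg] := geo (i a) (i b).
  exists (r \o g); rewrite -{1}(iK a) -{1}(iK b).
  by apply: (contraction_geodesic mY rL _ gg); rewrite !iK iI.
exists delta => x y z al be ga.
have seg a b A : is_geodesic_segment dY a b A ->
    is_geodesic_segment dX (i a) (i b) (i @` A).
  move=> [g gg ->]; exists (i \o g); last by rewrite iI image_comp.
  apply: (contraction_geodesic _ _ _ gg) => // a' b'; by rewrite iI.
move=> /seg sa /seg sb /seg sg P alP.
have iP : (i @` al) (i P) by exists P.
have [Q [] [q hq <-]] := hyp _ _ _ _ _ _ sa sb sg _ iP; rewrite iI => le.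
  by exists q => //; left.
by exists q => //; right.
Qed.

(** * Maps of metric graphs *)

(** Edges may be collapsed to vertices, as happens under folding. *)
Definition graph_map (T U : Type) (adjT : T -> T -> Prop) (adjU : U -> U -> Prop)
    (f : T -> U) : Prop :=
  forall u v, adjT u v -> f u = f v \/ adjU (f u) (f v).

Lemma edge_coord_refl (R : realType) (T : choiceType) (u : T) (t : R) :
  edge_coord u u t = edge_coord u u 0.
Proof. by apply/funext => w; rewrite /edge_coord; ring. Qed.

(** The right-hand side is the pushforward of the barycentric coordinates along
    [f]; the sum depends only on the point [edge_coord u v t], not on the edge
    and the parameter representing it. *)
Lemma edge_coord_pushforward (R : realType) (T U : choiceType) (f : T -> U)
    (s : seq T) (u v : T) (t : R) (w : U) :
  uniq s -> u \in s -> v \in s ->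
  \sum_(a <- s) edge_coord u v t a * (f a == w)%:R = edge_coord (f u) (f v) t w.
Proof.
move=> us hu hv; rewrite /edge_coord.
have E x : x \in s -> \sum_(a <- s) (a == x)%:R * (f a == w)%:R = (w == f x)%:R :> R.
  move=> hx; rewrite (bigD1_seq x) //= eqxx mul1r big1 ?addr0 1?eq_sym //.
  by move=> a /negPf ->; rewrite mul0r.
rewrite -(E u) // -(E v) // !mulr_sumr -big_split /=.
by apply: eq_bigr => a _; ring.
Qed.

Lemma edge_coord_image (R : realType) (T U : choiceType) (f : T -> U)
    (u v u' v' : T) (t t' : R) :
  edge_coord u v t = edge_coord u' v' t' ->
  edge_coord (f u) (f v) t = edge_coord (f u') (f v') t'.
Proof.
move=> E; apply/funext => w; pose s := undup [:: u; v; u'; v'].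
have us : uniq s by exact: undup_uniq.
rewrite -(@edge_coord_pushforward R T U f s) ?mem_undup ?inE ?eqxx ?orbT //.
by rewrite E edge_coord_pushforward // ?mem_undup ?inE ?eqxx ?orbT.
Qed.

Lemma realization_map (R : realType) (T U : choiceType)
    (adjT : T -> T -> Prop) (adjU : U -> U -> Prop) (f : T -> U) :
  graph_map adjT adjU f ->
  exists F : realization R adjT -> realization R adjU,
    forall x u v t, val x = edge_coord u v t ->
      val (F x) = edge_coord (f u) (f v) t.
Proof.
move=> fG.
suff key (x : realization R adjT) : exists y : realization R adjU,
    forall u v t, val x = edge_coord u v t ->
      val y = edge_coord (f u) (f v) t.
  by have [F FE] := choice key; exists F.
have [p Rp hp] : exists2 p, realization R adjU p & forall u v t,
    val x = edge_coord u v t -> p = edge_coord (f u) (f v) t.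
  have /set_mem [[u xu]|[u [v [t [uv t01 xu]]]]] := valP x.
    exists (edge_coord (f u) (f u) 0); first by left; exists (f u).
    by move=> u' v' t'; rewrite xu => /(edge_coord_image f).
  exists (edge_coord (f u) (f v) t); last first.
    by move=> u' v' t'; rewrite xu => /(edge_coord_image f).
  case: (fG _ _ uv) => [->|a]; first by left; exists (f v); exact: edge_coord_refl.
  by right; exists (f u), (f v), t.
by exists (SigSub (mem_set Rp)).
Qed.

Section PathMetric.
Context (R : realType) (T : choiceType) (adj : T -> T -> Prop).
Implicit Types x y : realization R adj.

Lemma pl_path_ge0 x y l : pl_path x y l -> 0 <= l.
Proof. by elim=> // *; exact: addr_ge0. Qed.

(** Points in different components would be at the junk distance [inf set0 = 0]
    without being equal. *)
Lemma metric_pl_path x y :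
  is_metric (@graph_dist R T adj) -> exists l, pl_path x y l.
Proof.
move=> [d0 _ _]; apply: contrapT => np.
have E : x = y.
  apply/d0; rewrite /graph_dist (_ : [set l | _] = set0) ?inf0 //.
  by rewrite -subset0 => l hl; apply: np; exists l.
by apply: np; exists 0; rewrite E; exact: pl_path_nil.
Qed.

End PathMetric.

Section Contraction.
Context (R : realType) (T U : choiceType).
Context (adjT : T -> T -> Prop) (adjU : U -> U -> Prop) (f : T -> U).
Context (F : realization R adjT -> realization R adjU).
Hypothesis fG : graph_map adjT adjU f.
Hypothesis FE : forall x u v t,
  val x = edge_coord u v t -> val (F x) = edge_coord (f u) (f v) t.

Lemma pl_path_map x y l :
  pl_path x y l -> exists2 l', pl_path (F x) (F y) l' & l' <= l.
Proof.
elim=> [z|{}x {}y z u v s t {}l uv s01 t01 xE yE _ [l' p le]].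
  by exists 0 => //; exact: pl_path_nil.
case: (fG uv) => [e|a].
  (* the edge is collapsed, so this piece of the path disappears *)
  exists l'; last by rewrite (le_trans le) // lerDr.
  suff -> : F x = F y by [].
  apply: val_inj; rewrite (FE xE) (FE yE) e.
  by rewrite (edge_coord_refl _ s) (edge_coord_refl _ t).
exists (`|s - t| + l'); last by rewrite lerD2l.
by apply: (pl_path_cons a s01 t01 _ _ p); exact: FE.
Qed.

(** A path from [x] to [y] is needed: without one the right-hand side is
    [inf set0 = 0]. *)
Lemma graph_dist_map x y :
  (exists l, pl_path x y l) -> graph_dist (F x) (F y) <= graph_dist x y.
Proof.
move=> ne; apply: lb_le_inf => // l /= /pl_path_map [l' p le].
by apply: le_trans le; apply: ge_inf => //; exists 0 => m; exact: pl_path_ge0.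
Qed.

End Contraction.

(** Both extended maps are contractions and their composite is the identity, so
    the one induced by [i] is isometric. *)
Lemma hyperbolic_graph_retract (R : realType) (T U : choiceType)
    (adjT : T -> T -> Prop) (adjU : U -> U -> Prop) (i : U -> T) (r : T -> U) :
  graph_map adjU adjT i -> graph_map adjT adjU r -> cancel i r ->
  hyperbolic (@graph_dist R T adjT) -> hyperbolic (@graph_dist R U adjU).
Proof.
move=> iG rG iK hyp.
have [I IE] := realization_map R iG; have [P PE] := realization_map R rG.
have IK : cancel I P.
  move=> x; apply: val_inj.
  have xE : exists u v (t : R), val x = edge_coord u v t.
    have /set_mem [[u xu]|[u [v [t [_ _ xu]]]]] := valP x.
      by exists u, u, 0.
    by exists u, v, t.
  case: xE => u [v [t xE]]; by rewrite (PE _ _ _ _ (IE _ _ _ _ xE)) !iK xE.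
have conT x y : exists l, pl_path (R := R) (adj := adjT) x y l.
  by apply: metric_pl_path; case: hyp => [[]].
have conU x y : exists l, pl_path (R := R) (adj := adjU) x y l.
  have [l /(pl_path_map rG PE)] := conT (I x) (I y).
  by rewrite !IK => -[l' p _]; exists l'.
apply: (hyperbolic_retract _ _ IK hyp) => [a b|a b].
  apply/le_anti/andP; split; first exact: (graph_dist_map iG IE).
  by rewrite -{1}(IK a) -{1}(IK b); exact: (graph_dist_map rG PE).
exact: (graph_dist_map rG PE).
Qed.

(** * Chambers and panels of the Coxeter complex *)

Section Generated.
Variable W : groupType.
Implicit Types (X : set W) (w x : W).

Lemma gen_subgroup X : is_subgroup (gen X).
Proof.
split=> [H [[? _ _] _] //|x y Hx Hy H HX|x Hx H HX].
  by have [[_ HM _] _] := HX; apply: HM; [exact: Hx|exact: Hy].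
by have [[_ _ HV] _] := HX; apply: HV; exact: Hx.
Qed.

Lemma gen_involution x : (x * x)%g = 1%g -> gen [set x] = [set 1%g; x].
Proof.
move=> xx; apply/seteqP; split.
  apply: smallest_sub; last by move=> y ->; right.
  have xV : (x^-1)%g = x by rewrite -[LHS]mulg1 -xx mulgA mulVg mul1g.
  split=> [|a b [->|->] [->|->]|a [->|->]]; rewrite ?mul1g ?mulg1 ?invg1 ?xV ?xx;
    by [left|right].
move=> y [->|->]; first by have [] := gen_subgroup [set x].
exact: sub_gen_smallest.
Qed.

Lemma gen0 : gen (@set0 W) = [set 1%g].
Proof.
apply/seteqP; split; last by move=> y ->; have [] := gen_subgroup (@set0 W).
apply: smallest_sub => //.
by split=> [//|x y -> ->|x ->]; rewrite /= ?mulg1 ?invg1.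
Qed.

End Generated.

Definition panel (V : choiceType) (F C : {fset V}) : Prop :=
  (F `<=` C)%fset /\ #|` C| = #|` F|.+1.

Lemma panel_cover (V : choiceType) (F C : {fset V}) :
  (F `<=` C)%fset -> F <> C ->
  (forall G : {fset V}, (F `<=` G)%fset -> (G `<=` C)%fset -> G = F \/ G = C) ->
  panel F C.
Proof.
move=> FC nFC cov; split=> //.
have : (F `<` C)%fset by rewrite fproperEneq FC andbT; exact/eqP.
rewrite fproperE => /andP[_ /fsubsetPn [v vC vF]].
case: (cov (v |` F)%fset).
- exact: fsubsetU1.
- by rewrite fsubUset fsub1set vC.
- by move=> E; move: vF; rewrite -E !inE eqxx.
- by move=> <-; rewrite cardfsU1 vF.
Qed.

Section CoxeterComplex.
Variables (W : groupType) (S : {fset W}) (V : choiceType) (A : set {fset V}).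
Hypothesis S2 : forall s, s \in S -> has_order s 2.
Hypothesis cA : simplicial_complex A.
Hypothesis iA : iso_coxeter_complex S A.

(** The chamber [c w] corresponds to the coset [{w}], and a simplex [F] is a face
    of it exactly when [w] is in the coset of [F].  The panels are the cosets
    [{w, w s}]: a coset [w W_J] with [s] in [J] contains [{w, w s}], which is
    the coset of a simplex between that of [w W_J] and the chamber [{w}].  The
    last clause says that a panel is in at most two chambers. *)
Lemma coxeter_chambers : exists c : W -> {fset V},
  [/\ injective c,
      forall C, is_chamber A C <-> exists w, C = c w,
      forall F, A F -> exists w, (F `<=` c w)%fset,
      forall w s, s \in S -> exists2 F, panel F (c w) & panel F (c (w * s)%g)
    & forall F w, panel F (c w) -> exists2 s, s \in S &
        forall w', (F `<=` c w')%fset -> w' = w \/ w' = (w * s)%g].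
Proof.
case: iA => phi [phiA phi_inj phi_surj] phi_le.
have S2' s : s \in S -> (s * s)%g = 1%g /\ s <> 1%g.
  move=> /S2 [_ s2 smin]; split; first by rewrite -expg2.
  by move=> s1; have := smin 1 isT; rewrite s1 expg1n => /(_ erefl).
have std1 w : standard_cosets S [set w].
  by exists w, set0; split=> //; rewrite gen0 image_set1 mulg1.
have std2 w s : s \in S -> standard_cosets S [set w; (w * s)%g].
  move=> sS; exists w, [set s]; split; first by move=> x ->.
  by rewrite gen_involution ?image_setU ?image_set1 ?mulg1 //; case: (S2' _ sS).
have phi_n0 F : A F -> exists w, phi F w.
  move=> /phiA [w [J [_ ->]]]; exists w, 1%g; last by rewrite mulg1.
  by have [] := gen_subgroup J.
have /choice [c cP] (w : W) : exists F, A F /\ phi F = [set w].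
  by have [F AF E] := phi_surj _ (std1 w); exists F.
have Ac w : A (c w) by case: (cP w).
have phic w : phi (c w) = [set w] by case: (cP w).
have in_c F w : A F -> (F `<=` c w)%fset <-> phi F w.
  move=> AF; rewrite phi_le // phic; split=> [|h x ->//]; exact.
have c_inj : injective c.
  by move=> w w' E; have : [set w] w by []; rewrite -phic E phic.
have c_max w D : A D -> (c w `<=` D)%fset -> D = c w.
  move=> AD; rewrite phi_le // phic => h; apply: phi_inj; rewrite ?inE //.
  rewrite phic; apply/seteqP; split=> // x ->.
  by have [y hy] := phi_n0 _ AD; have /= <- := h y hy.
exists c; split=> //.
- move=> C; split=> [[AC Cmax]|[w ->]]; last by split=> // D AD /(c_max _ _ AD).
  have [w Cw] := phi_n0 _ AC; exists w; symmetry; apply: Cmax => //.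
  exact/in_c.
- by move=> F AF; have [w Fw] := phi_n0 _ AF; exists w; exact/in_c.
- move=> w s sS; have [ss s1] := S2' _ sS.
  have ws : (w * s)%g <> w by rewrite -{2}[w]mulg1 => /mulgI.
  have [F AF phiF] := phi_surj _ (std2 w s sS).
  (* no coset lies strictly between [{u}] and [{u, u'}] *)
  have step u u' : phi F = [set u; u'] -> u' <> u -> panel F (c u).
    move=> E nu; apply: panel_cover => [|E'|G FG Gc].
    + by apply/in_c => //; rewrite E; left.
    + have : phi F u' by rewrite E; right.
      by rewrite E' phic.
    + have AG : A G by case: cA => _ down; exact: down (Ac _) Gc.
      have Gu : phi G u by exact/in_c.
      case: (pselect (phi G u')) => Gu'.
        left; apply: phi_inj; rewrite ?inE //; rewrite E; apply/seteqP; split.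
          by rewrite -E; apply/phi_le.
        by move=> x [->|->].
      right; apply: phi_inj; rewrite ?inE // phic; apply/seteqP; split.
        move=> x Gx; have : phi F x by move: x Gx; apply/phi_le.
        by rewrite E => -[//|xu]; case: Gu'; rewrite -xu.
      by move=> x ->.
  exists F; first exact: step phiF ws.
  by apply: (step _ w) => [|/esym //]; rewrite phiF setUC.
- move=> F w [Fw cardF].
  have AF : A F by case: cA => _ down; exact: down (Ac _) Fw.
  have Fphi : phi F w by exact/in_c.
  have [w0 [J [JS E]]] := phiA _ AF.
  have [gJ1 gJM gJV] := gen_subgroup J.
  have [x0 Jx0 x0E] : [set (w0 * x)%g | x in gen J] w by rewrite -E.
  case: (pselect (exists s, J s)) => [[s Js]|nJ]; last first.
    (* then [phi F] is a single element, so [F] would be the chamber itself *)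
    have J0 : J = set0 by rewrite -subset0 => x Jx; apply: nJ; exists x.
    have : F = c w.
      apply: phi_inj; rewrite ?inE // phic E J0 gen0 image_set1 mulg1.
      by move: Jx0 x0E; rewrite J0 gen0 /= => -> <-; rewrite mulg1.
    by move=> e; move: cardF; rewrite -e => /n_Sn.
  have sS : s \in S by exact: JS.
  have [G AG phiG] := phi_surj _ (std2 w s sS).
  have FG : (F `<=` G)%fset.
    apply/phi_le => //; rewrite phiG => x [->//|->]; rewrite E.
    exists (x0 * s)%g; last by rewrite mulgA x0E.
    by apply: gJM => //; exact: sub_gen_smallest.
  have Gw : (G `<=` c w)%fset by apply/in_c; rewrite // phiG; left.
  have GF : G = F.
    apply/eqP; rewrite eq_sym eqEfcard FG /= -ltnS -cardF ltn_neqAle.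
    rewrite fsubset_leq_card // andbT; apply/eqP => e.
    have Gc : G = c w by apply/eqP; rewrite eqEfcard Gw e leqnn.
    have : phi G (w * s)%g by rewrite phiG; right.
    rewrite Gc phic /= -{2}[w]mulg1 => /mulgI; by case: (S2' _ sS).
  exists s => // w' /in_c; rewrite -GF phiG; by move/(_ AG).
Qed.

End CoxeterComplex.

(** * Isomorphisms of apartments *)

Section SimplicialIso.
Variables (V : choiceType) (A B : set {fset V}) (f : V -> V).
Hypothesis cA : simplicial_complex A.
Hypothesis fAB : simplicial_iso A B f.
Implicit Types F G C : {fset V}.

Lemma iso_vertex_inj F G v w :
  A F -> A G -> v \in F -> w \in G -> f v = f w -> v = w.
Proof.
move=> AF AG vF wG fvw; case: fAB => _ finj _; case: cA => _ down.
have : [fset v]%fset = [fset w]%fset.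
  apply: finj; last by rewrite !imfset_fset1 fvw.
    by apply/mem_set/(down _ _ AF); rewrite fsub1set.
  by apply/mem_set/(down _ _ AG); rewrite fsub1set.
by move/fset1_inj.
Qed.

Lemma iso_subset F G : A F -> A G -> (f @` F `<=` f @` G)%fset -> (F `<=` G)%fset.
Proof.
move=> AF AG /fsubsetP h; apply/fsubsetP => v vF.
have /imfsetP [w wG fvw] := h _ (in_imfset imfset_key f vF).
by rewrite (iso_vertex_inj AF AG vF wG fvw).
Qed.

Lemma iso_panel F C : A F -> A C -> panel F C -> panel (f @` F)%fset (f @` C)%fset.
Proof.
have card G : A G -> #|` (f @` G)%fset| = #|` G|.
  by move=> AG; apply: card_in_imfset => v w /= vG wG; exact: iso_vertex_inj vG wG.
move=> AF AC [FC cardF]; split; last by rewrite !card.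
apply: subset_imfset; exact: (fsubsetP FC).
Qed.

Lemma iso_chamber C : is_chamber A C -> is_chamber B (f @` C)%fset.
Proof.
case: fAB => fA _ fsurj [AC Cmax]; split; first exact: fA.
by move=> D BD; have [E AE <-] := fsurj _ BD => /(iso_subset AC AE) /(Cmax _ AE) ->.
Qed.

End SimplicialIso.

Lemma simplicial_iso_id (V : choiceType) (A : set {fset V}) : simplicial_iso A A id.
Proof.
rewrite /simplicial_iso.
split=> [F AF|F G _ _|F AF]; rewrite /= ?imfset_id //.
by exists F; rewrite // imfset_id.
Qed.

Lemma simplicial_iso_comp (V : choiceType) (A B C : set {fset V}) (f g : V -> V) :
  simplicial_iso A B f -> simplicial_iso B C g -> simplicial_iso A C (g \o f).
Proof.
move=> fAB gBC; rewrite /simplicial_iso.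
rewrite (_ : (fun F : {fset V} => _) =
  (fun F : {fset V} => g @` F)%fset \o (fun F : {fset V} => f @` F)%fset).
  exact: set_bij_comp fAB gBC.
by apply/funext => F /=; rewrite imfset_comp.
Qed.

(** * The retraction onto an apartment *)

Section Building.
Variables (W : groupType) (S : {fset W}) (V : choiceType).
Hypothesis S2 : forall s, s \in S -> has_order s 2.
Hypothesis genS : gen [set` S] = setT.
Implicit Types (A B : set {fset V}) (C D E F G : {fset V}) (f g : V -> V).

(** If [f] and [g] agree on one chamber they agree on its neighbours, because a
    panel of [B] is in only two chambers; since [S] generates [W], every chamber
    of [A] is reached in this way. *)
Lemma iso_rigid A B C f g :
  simplicial_complex A -> iso_coxeter_complex S A ->
  simplicial_complex B -> iso_coxeter_complex S B ->
  simplicial_iso A B f -> simplicial_iso A B g -> is_chamber A C ->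
  {in C, f =1 g} -> forall F, A F -> (f @` F = g @` F)%fset.
Proof.
move=> cA iA cB iB fAB gAB AC fgC.
have [a [a_inj aP a_cov a_adj _]] := coxeter_chambers S2 cA iA.
have [b [_ bP _ _ b_thin]] := coxeter_chambers S2 cB iB.
have Aa w : A (a w) by have [] := (aP (a w)).2 (ex_intro _ w erefl).
have down F G : (F `<=` G)%fset -> A G -> A F.
  by case: cA => _ h FG AG; exact: h FG.
(* the agreement of f and g crosses every panel, because in B a panel lies
   in only one chamber besides a given one *)
have step w s : s \in S -> {in a w, f =1 g} -> {in a (w * s)%g, f =1 g}.
  move=> sS fg; have [F Fw Fws] := a_adj w s sS.
  have AF : A F := down _ _ Fw.1 (Aa w).
  have fgF : (f @` F = g @` F)%fset.
    apply: eq_in_imfset => // v vF; exact/fg/(fsubsetP Fw.1).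
  have [x fx] : exists x, (f @` a w)%fset = b x.
    by apply/bP; apply: (iso_chamber cA fAB); apply/aP; exists w.
  have fgw : (f @` a w = g @` a w)%fset by apply: eq_in_imfset.
  have nws : a (w * s)%g <> a w.
    move=> /a_inj; rewrite -{2}[w]mulg1 => /mulgI s1.
    by have [_ _ /(_ 1%N isT)] := S2 sS; rewrite s1 expg1n => /(_ erefl).
  have [y fy] : exists y, (f @` a (w * s)%g)%fset = b y.
    by apply/bP; apply: (iso_chamber cA fAB); apply/aP; exists (w * s)%g.
  have [z gz] : exists z, (g @` a (w * s)%g)%fset = b z.
    by apply/bP; apply: (iso_chamber cA gAB); apply/aP; exists (w * s)%g.
  have := iso_panel cA fAB AF (Aa w) Fw; rewrite fx => /b_thin [t _ thin].
  have yx : y <> x.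
    move=> e; apply: nws; case: fAB => _ finj _; apply: finj; rewrite ?inE //.
    by rewrite fy e fx.
  have zx : z <> x.
    move=> e; apply: nws; case: gAB => _ ginj _; apply: ginj; rewrite ?inE //.
    by rewrite gz e -fgw fx.
  have fgE : (f @` a (w * s)%g = g @` a (w * s)%g)%fset.
    have [Ff _] := iso_panel cA fAB AF (Aa _) Fws.
    have [Fg _] := iso_panel cA gAB AF (Aa _) Fws.
    rewrite fy gz; move: Ff Fg; rewrite -fgF fy gz => /thin [//|->] /thin [//|->].
    by [].
  move=> v vE; case: (boolP (v \in F)) => vF; first exact/fg/(fsubsetP Fw.1).
  (* v is the only vertex of its chamber off the panel F *)
  have EF : a (w * s)%g = (v |` F)%fset.
    apply/esym/eqP; rewrite eqEfcard fsubUset fsub1set vE Fws.1 /=.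
    by rewrite cardfsU1 vF Fws.2.
  have : f v \in (g @` a (w * s)%g)%fset by rewrite -fgE; exact: in_imfset.
  rewrite EF => /imfsetP [u] /=; rewrite !inE => /orP[/eqP->//|uF] fvu.
  have : f v \in (f @` F)%fset by rewrite fgF fvu; exact: in_imfset.
  move=> /imfsetP [u' /= u'F fvu']; move: vF.
  by rewrite (iso_vertex_inj cA fAB (Aa _) AF vE u'F fvu') u'F.
have stepV w s : s \in S -> {in a (w * s)%g, f =1 g} -> {in a w, f =1 g}.
  move=> sS /(step _ s sS); rewrite -mulgA.
  by have [_ s2 _] := S2 sS; rewrite -expg2 s2 mulg1.
have all_w x w : {in a w, f =1 g} <-> {in a (w * x)%g, f =1 g}.
  have : gen [set` S] x by rewrite genS.
  move=> /(_ [set x | forall w, {in a w, f =1 g} <-> {in a (w * x)%g, f =1 g}]).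
  apply; split=> [|s sS w']; last by split; [exact: step|exact: stepV].
  split=> [w'|y z hy hz w'|y hy w'] /=; first by rewrite mulg1.
    by rewrite mulgA -hz -hy.
  by rewrite (hy (w' * y^-1)%g) -mulgA mulVg mulg1.
move=> F /a_cov [w Fw]; apply: eq_in_imfset => // v vF.
have /aP [w0 C0] := AC.
have: {in a w, f =1 g}.
  have := (all_w (w0^-1 * w)%g w0).1; rewrite mulgA mulgV mul1g; apply.
  by rewrite -C0.
by apply; exact: (fsubsetP Fw).
Qed.

(** [i] numbers the chambers of an apartment by [W], and [r] is the retraction
    onto that apartment centred at the chamber numbered [1]. *)
Theorem building_retraction (Delta : set {fset V}) :
  building S Delta ->
  exists (i : W -> is_chamber Delta) (r : is_chamber Delta -> W),
    [/\ graph_map (cayley_adj S) (@chamber_adj V Delta) i,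
        graph_map (@chamber_adj V Delta) (cayley_adj S) r & cancel i r].
Proof.
move=> [[D0 Ddown] [Apt [DeltaE AptC common iso]]].
have [A [AptA _ _]] := common _ _ D0 D0.
have AptD B F : Apt B -> B F -> Delta F by move=> ? ?; rewrite DeltaE; exists B.
have [cA iA] := AptC _ AptA.
have [c [c_inj cP c_cov c_adj c_thin]] := coxeter_chambers S2 cA iA.
have Ac w : A (c w) by have [] := (cP (c w)).2 (ex_intro _ w erefl).
have chamber_apt B D : Apt B -> B D -> is_chamber Delta D -> is_chamber B D.
  by move=> AB BD [_ Dmax]; split=> // E BE; apply: Dmax; exact: AptD BE.
pose C := c 1%g.
have fixC f : (forall v, v \in (C `|` C)%fset -> f v = v) -> {in C, f =1 id}.
  by move=> h v vC; apply: h; rewrite in_fsetU vC.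
(* A simplex of Delta above [c w] is in a common apartment with it, and is
   carried into [A] by an isomorphism that fixes [c w], where [c w] is maximal. *)
have Dc w : is_chamber Delta (c w).
  split=> [|G DG cG]; first exact: AptD (Ac w).
  have [B [AptB Bc BG]] := common _ _ (AptD _ _ AptA (Ac w)) DG.
  have [f [fBA ff]] := iso _ _ _ _ AptB AptA Bc Bc (Ac w) (Ac w).
  have [cB _] := AptC _ AptB.
  have fc : (f @` c w = c w)%fset.
    rewrite -[RHS]imfset_id; apply: eq_in_imfset => // v vc.
    by apply: ff; rewrite in_fsetU vc.
  have [_ wmax] := (cP (c w)).2 (ex_intro _ w erefl).
  have fG : (f @` G = c w)%fset.
    apply: wmax; first by case: fBA => fB _ _; exact: fB.
    by rewrite -{1}fc; apply: subset_imfset; exact: (fsubsetP cG).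
  apply/eqP; rewrite eq_sym eqEfcard cG /=.
  apply: fsubset_leq_card; apply: (iso_subset cB fBA) => //.
  by rewrite fG fc.
(* the isomorphisms of which the retraction is made *)
pose retr B f := [/\ Apt B, B C, simplicial_iso B A f & {in C, f =1 id}].
have retrP D : is_chamber Delta D -> exists w B f,
    [/\ retr B f, B D & (f @` D)%fset = c w].
  move=> chD; have [B [AptB BC BD]] := common _ _ (Dc 1%g).1 chD.1.
  have [f [fBA ff]] := iso _ _ _ _ AptB AptA BC BC (Ac _) (Ac _).
  have [cB _] := AptC _ AptB.
  have /cP [w fD] := iso_chamber cB fBA (chamber_apt _ _ AptB BD chD).
  by exists w, B, f; split=> //; split=> //; exact: fixC.
(* An isomorphism [B -> B'] fixing [C] and [F] shows that [f] and [f'] agree on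
   [F]: after composition with it, [f'] is an isomorphism [B -> A] that agrees
   with [f] on [C]. *)
have retr_indep B B' f f' F : retr B f -> retr B' f' -> B F -> B' F ->
    (f @` F = f' @` F)%fset.
  move=> [AptB BC fBA fC] [AptB' BC' fBA' fC'] BF BF'.
  have [g [gBB gg]] := iso _ _ _ _ AptB AptB' BC BF BC' BF'.
  have gF : (g @` F = F)%fset.
    rewrite -[RHS]imfset_id; apply: eq_in_imfset => // v vF.
    by apply: gg; rewrite in_fsetU vF orbT.
  transitivity ((f' \o g) @` F)%fset; last by rewrite imfset_comp gF.
  have [cB iB] := AptC _ AptB.
  apply: (iso_rigid cB iB cA iA fBA (simplicial_iso_comp gBB fBA') _ _ BF).
    exact: chamber_apt AptB BC (Dc 1%g).
  by move=> v vC /=; rewrite fC // gg ?fC' // in_fsetU vC.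
have /choice [r rP] (D : is_chamber Delta) : exists w, exists B f,
    [/\ retr B f, B (val D) & (f @` val D)%fset = c w].
  exact: (retrP _ (set_mem (valP D))).
pose i (w : W) : is_chamber Delta := SigSub (mem_set (Dc w)).
exists i, r; split.
- move=> w w' [nw [s sS ww']]; right; split; first by move=> /c_inj.
  have [F Fw Fw'] : exists2 F, panel F (c w) & panel F (c w').
    case: ww' => ->; first exact: c_adj.
    by have [F ? ?] := c_adj w' s sS; exists F.
  by exists F; case: Fw; case: Fw'.
(* The panel [F] common to [D] and [E] has the same image under the two
   isomorphisms used for [D] and [E], and that image is a panel of both
   [c (r D)] and [c (r E)]. *)
- move=> D E [_ [F [FD FE cD cE]]].
  have [B [f [rf BD fD]]] := rP D; have [B' [f' [rf' BE fE]]] := rP E.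
  have [[AptB _ fBA _] [AptB' _ fBA' _]] := (rf, rf').
  have [[cB _] [cB' _]] := (AptC _ AptB, AptC _ AptB').
  have BF : B F by case: (cB) => _ h; exact: h BD FD.
  have BF' : B' F by case: (cB') => _ h; exact: h BE FE.
  have pD := iso_panel cB fBA BF BD (conj FD cD).
  have [pE _] := iso_panel cB' fBA' BF' BE (conj FE cE).
  move: pD pE; rewrite fD fE (retr_indep _ _ _ _ _ rf rf' BF BF').
  move=> /c_thin [s sS h] /h [->|rE]; first by left.
  case: (pselect (r D = r E)) => [|n]; first by left.
  by right; split=> //; exists s => //; left.
- move=> w; have [B [f [rf Bw fw]]] := rP (i w).
  have rid : retr A id by split=> //; [exact: Ac|exact: simplicial_iso_id].
  by apply: c_inj; rewrite -fw (retr_indep _ _ _ _ _ rf rid Bw (Ac w)) imfset_id.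
Qed.

End Building.

Theorem mainTheorem2 (R : realType) (W : groupType) (S : {fset W})
    (V : choiceType) (Delta : set {fset V}) :
  coxeter_system S ->
  building S Delta ->
  hyperbolic (@dual_graph_dist R V Delta) ->
  word_hyperbolic R W.
Proof.
move=> [S2 genS _] bD hyp; exists S; split=> //.
have [i [r [iG rG iK]]] := building_retraction S2 genS bD.
exact: hyperbolic_graph_retract iG rG iK hyp.
Qed.
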